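(* Let $r\in\mathbb{N}$, and for every $n$ let $\mathcal{O}$ be any positive-dominant ordering on $\mathfrak{C}(r,n)$. Then, as an identity of formal power series, $$\sum_{n\ge 0}\frac{\sum_{\gamma\in\mathfrak{G}(r,n)}t^{des_{\mathcal{O}}(\gamma)}\,q^{maj_{\mathcal{O}}(\gamma)}\,p^{len_{\mathcal{O}}(\gamma)}\,a^{col(\gamma)}}{\prod_{i=0}^{n}(1-tq^i)}\cdot\frac{u^n}{[n]_{r,a,p}!}=\sum_{k\ge 0}t^k\left(\prod_{j=0}^{k-1}e[q^ju]_p\right) e[q^ku]_{r,a,p}.$$
   Context: Notation: $\mathbb{N}=\{1,2,\dots\}$; for integers $a\le b$, $[a,b]=\{a,a+1,\dots,b\}$ and $[n]=[1,n]$; $\chi$ of a statement is $1$ if it is true and $0$ otherwise. Colored permutations: $\mathfrak{G}(r,n)=\mathbb{Z}_r\wr S_n$ is the set of $\gamma=(\gamma(1),\dots,\gamma(n))=(\pi(1)^{c_1},\dots,\pi(n)^{c_n})$ with $\pi\in S_n$ and colors $c_i\in[0,r-1]$; an entry $j^0$ is written $j$. For $n=0$ this set has a single (empty) element, all of whose statistics are $0$. Colored entries: $\mathfrak{C}(r,n)=\{0,1,\dots,n\}\cup\{j^c : j\in[n],\ c\in[1,r-1]\}$ (with $j^0=j$). A total order on $\mathfrak{C}(r,n)$ is positive-dominant if (1) $0<1<2<\dots<n$, and (2) $i>j^c$ for all $i\in[0,n]$, $j\in[n]$, $c>0$. Statistics: for a total order $\mathcal{O}$ on $\mathfrak{C}(r,n)$,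 all comparisons being with respect to $\mathcal{O}$, and with $\gamma(0)=0$: $Des_{\mathcal{O}}(\gamma)=\{j\in[0,n-1] : \gamma(j)>\gamma(j+1)\}$; $des_{\mathcal{O}}(\gamma)=\#Des_{\mathcal{O}}(\gamma)$; $maj_{\mathcal{O}}(\gamma)=\sum_{j\in Des_{\mathcal{O}}(\gamma)}j$; $inv_{\mathcal{O}}(\gamma)=\#\{(i,j) : 1\le i<j\le n,\ \gamma(i)>\gamma(j)\}$; $len_{\mathcal{O}}(\gamma)=inv_{\mathcal{O}}(\gamma)+\sum_{i:\,c_i>0}(\pi(i)+c_i-1)$; $col(\gamma)=\sum_{i=1}^n c_i$. $q$-notation: $[n]_p=1+p+\dots+p^{n-1}$, $[n]_p!=[n]_p[n-1]_p\cdots[1]_p$, $[0]_p!=1$, $e[u]_p=\sum_{n\ge0}\frac{u^n}{[n]_p!}$. Further, $[n]_{r,a,p}=\left(\sum_{j=0}^{r-1}(a^jp^{j+n-1})^{\chi(j>0)}\right)[n]_p$ (so the $j=0$ term in the parenthesis equals $1$), $[n]_{r,a,p}!=\prod_{k=1}^n[k]_{r,a,p}$ (with $[0]_{r,a,p}!=1$), and $e[u]_{r,a,p}=\sum_{n\ge0}\frac{u^n}{[n]_{r,a,p}!}$. *)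

(* Defs.v *)
From HB Require Import structures.
From mathcomp Require Import all_boot all_order all_algebra all_fingroup.
From mathcomp Require Import boolp.

Set Implicit Arguments.
Unset Strict Implicit.
Unset Printing Implicit Defensive.

Import GRing.Theory.

(* Formal power series in one variable.  Since fps R is again a               *)
(* comUnitRingType when R is one, series in several variables are obtained by *)
(* iterating the construction: R[[x, y]] is fps (fps R).                      *)

Local Open Scope ring_scope.

Record fps (R : Type) : Type := Fps { fps_coef :> nat -> R }.

Lemma fpsP (R : Type) (f g : fps R) : (forall n, f n = g n) -> f = g.
Proof. by case: f g => [f] [g] /= fg; congr Fps; apply: funext. Qed.

HB.instance Definition _ (R : Type) := gen_eqMixin (fps R).
HB.instance Definition _ (R : Type) := gen_choiceMixin (fps R).

Section FpsZmodule.
Variable R : zmodType.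
Implicit Types f g h : fps R.

Definition fps_zero : fps R := Fps (fun=> 0).
Definition fps_opp f := Fps (fun n => - f n).
Definition fps_add f g := Fps (fun n => f n + g n).

Fact fps_addA : associative fps_add.
Proof. by move=> f g h; apply: fpsP => n /=; rewrite addrA. Qed.
Fact fps_addC : commutative fps_add.
Proof. by move=> f g; apply: fpsP => n /=; rewrite addrC. Qed.
Fact fps_add0 : left_id fps_zero fps_add.
Proof. by move=> f; apply: fpsP => n /=; rewrite add0r. Qed.
Fact fps_addN : left_inverse fps_zero fps_opp fps_add.
Proof. by move=> f; apply: fpsP => n /=; rewrite addNr. Qed.

HB.instance Definition _ :=
  GRing.isZmodule.Build (fps R) fps_addA fps_addC fps_add0 fps_addN.

Lemma fps0E n : (0 : fps R) n = 0. Proof. by []. Qed.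
Lemma fpsNE f n : (- f) n = - f n. Proof. by []. Qed.
Lemma fpsDE f g n : (f + g) n = f n + g n. Proof. by []. Qed.

End FpsZmodule.

Section FpsRing.
Variable R : comNzRingType.
Implicit Types f g h : fps R.

Definition fpsC (c : R) : fps R := Fps (fun n => if n == 0%N then c else 0).
Definition fpsX : fps R := Fps (fun n => (n == 1%N)%:R).
Definition fps_mul f g : fps R :=
  Fps (fun n => \sum_(i < n.+1) f i * g (n - i)%N).

Let trunc n f : {poly R} := \poly_(i < n) f i.

Fact fps_mul_trunc f g n m : (m < n)%N ->
  fps_mul f g m = (trunc n f * trunc n g)`_m.
Proof.
move=> ltmn; rewrite coefM /=; apply: eq_bigr => i _; rewrite !coef_poly.
have le_im : (i <= m)%N by rewrite -ltnS.
by rewrite (leq_ltn_trans le_im ltmn) (leq_ltn_trans (leq_subr i m) ltmn).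
Qed.

Fact fps_mulA : associative fps_mul.
Proof.
move=> f g h; apply: fpsP => n; pose t := trunc n.+1.
transitivity (t f * (t g * t h))`_n.
  rewrite coefM; apply: eq_bigr => i _.
  rewrite (@fps_mul_trunc g h n.+1) ?ltnS ?leq_subr //.
  by rewrite [(t f)`_i]coef_poly ltn_ord.
rewrite mulrA coefM; apply: eq_bigr => i _.
rewrite (@fps_mul_trunc f g n.+1) //.
by rewrite [(t h)`_(n - i)]coef_poly ltnS leq_subr.
Qed.
Fact fps_mulC : commutative fps_mul.
Proof.
move=> f g; apply: fpsP => n.
by rewrite !(@fps_mul_trunc _ _ n.+1) // mulrC.
Qed.
Fact fps_mul1 : left_id (fpsC 1) fps_mul.
Proof.
move=> f; apply: fpsP => n /=; rewrite big_ord_recl /= mul1r subn0 big1 ?addr0 //.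
by move=> i _; rewrite mul0r.
Qed.
Fact fps_mulDl : left_distributive fps_mul (@fps_add R).
Proof.
move=> f g h; apply: fpsP => n /=; rewrite -big_split /=.
by apply: eq_bigr => i _; rewrite mulrDl.
Qed.
Fact fps_one_neq0 : fpsC 1 != 0.
Proof.
by apply/eqP => /(congr1 (fun f : fps R => f 0%N)) /eqP; rewrite /= oner_eq0.
Qed.

HB.instance Definition _ := GRing.Zmodule_isComNzRing.Build (fps R)
  fps_mulA fps_mulC fps_mul1 fps_mulDl fps_one_neq0.

Lemma fps1E n : (1 : fps R) n = (n == 0%N)%:R.
Proof. by rewrite /=; case: eqP. Qed.
Lemma fpsME f g n : (f * g) n = \sum_(i < n.+1) f i * g (n - i)%N.
Proof. by []. Qed.

(* f(X) |-> f(c X) *)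
Definition fps_dilate (c : R) f : fps R := Fps (fun n => c ^+ n * f n).

End FpsRing.

Section FpsUnit.
Variable R : comUnitRingType.
Implicit Types f g h : fps R.

Definition fps_unit : pred (fps R) := fun f => f 0%N \is a GRing.unit.

(* The first n coefficients of 1 / f, obtained by solving g * f = 1. *)
Fixpoint fps_inv_seq f n : seq R :=
  if n is m.+1 then
    let s := fps_inv_seq f m in
    rcons s (((m == 0%N)%:R - \sum_(i < m) s`_i * f (m - i)%N) / f 0%N)
  else [::].

Definition fps_inv f : fps R :=
  if fps_unit f then Fps (fun n => (fps_inv_seq f n.+1)`_n) else f.

Fact size_fps_inv_seq f n : size (fps_inv_seq f n) = n.
Proof. by elim: n => //= n IHn; rewrite size_rcons IHn. Qed.

Fact nth_fps_inv_seq f n i : (i < n)%N ->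
  (fps_inv_seq f n)`_i = (fps_inv_seq f i.+1)`_i.
Proof.
elim: n => // n IHn; rewrite ltnS leq_eqVlt => /predU1P[-> //|ltin].
by rewrite [LHS]/= nth_rcons size_fps_inv_seq ltin IHn.
Qed.

Fact fps_mulVx : {in fps_unit, left_inverse 1 fps_inv *%R}.
Proof.
move=> f Uf; apply: fpsP => n; rewrite fps1E fpsME /fps_inv.
rewrite -[fps_unit f]/(f \in fps_unit) Uf big_ord_recr subnn.
set g := Fps _; pose s := fps_inv_seq f n.
have -> : g (@ord_max n) =
    ((n == 0%N)%:R - \sum_(i < n) s`_i * f (n - i)%N) / f 0%N.
  by rewrite /g /= nth_rcons size_fps_inv_seq ltnn eqxx.
have -> : \sum_(i < n) s`_i * f (n - i)%N = \sum_(i < n) g i * f (n - i)%N.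
  by apply: eq_bigr => i _; rewrite /s (nth_fps_inv_seq f (ltn_ord i)).
by rewrite mulrVK //; exact: subrKC.
Qed.

Fact fps_unitPl f g : g * f = 1 -> fps_unit f.
Proof.
move=> /(congr1 (fun h : fps R => h 0%N)).
rewrite fpsME big_ord_recl big_ord0 addr0 fps1E mulrC => gf1.
by apply/unitrPr; exists (g 0%N).
Qed.

Fact fps_inv_out : {in [predC fps_unit], fps_inv =1 id}.
Proof.
move=> f /negPf nUf; rewrite /fps_inv.
by rewrite -[fps_unit f]/(f \in fps_unit) nUf.
Qed.

HB.instance Definition _ := GRing.ComNzRing_hasMulInverse.Build (fps R)
  fps_mulVx fps_unitPl fps_inv_out.

Lemma fps_unitE f : (f \is a GRing.unit) = (f 0%N \is a GRing.unit).
Proof. by []. Qed.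

End FpsUnit.

(* The series F 0 + F 1 + ... of elements of A[[x, y]] converges to S, i.e.   *)
(* every coefficient of the partial sums is eventually equal to that of S.    *)
Definition fps2_sums (A : comNzRingType) (F : nat -> fps (fps A))
    (S : fps (fps A)) : Prop :=
  forall m n, exists N, forall K, (N <= K)%N -> (\sum_(k < K) F k) m n = S m n.

Section QAnalogues.
Variable A : comUnitRingType.
Implicit Types (p a : A) (n r : nat).

Definition qint p n : A := \sum_(i < n) p ^+ i.
Definition qfact p n : A := \prod_(1 <= k < n.+1) qint p k.
Definition qexp p : fps A := Fps (fun n => (qfact p n)^-1).

(* Only used for 0 < n, where the truncated subtraction is the usual one. *)
Definition rqint r a p n : A :=
  (\sum_(j < r) (a ^+ j * p ^+ (j + n - 1)) ^+ (0 < j)%N) * qint p n.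
Definition rqfact r a p n : A := \prod_(1 <= k < n.+1) rqint r a p k.
Definition rqexp r a p : fps A := Fps (fun n => (rqfact r a p n)^-1).

End QAnalogues.

Local Close Scope ring_scope.

(* None is the entry 0, and Some (i, c) is the entry (i + 1)^c. *)
Definition centry (r n : nat) : Type := option ('I_n * 'I_r).

Section Entries.
Variables r n : nat.
Implicit Types (x y : centry r n) (le : rel (centry r n)).

Definition centry_val x : nat := if x is Some (i, _) then i.+1 else 0.
Definition centry_col x : nat := if x is Some (_, c) then c : nat else 0.

Definition total_order le : Prop :=
  [/\ reflexive le, antisymmetric le, transitive le & total le].

Definition strictly le x y : bool := (x != y) && le x y.

Definition positive_dominant le : Prop :=
  [/\ total_order le,
      forall x y, centry_col x = 0 -> centry_col y = 0 ->
        centry_val x < centry_val y -> strictly le x y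
    & forall x y, centry_col x = 0 -> 0 < centry_col y -> strictly le y x].

End Entries.

(* The pair (pi, c) is the word (pi(1)^c_1, ..., pi(n)^c_n), with positions   *)
(* and values shifted down by one.                                            *)
Definition cperm (r n : nat) : Type := ('S_n * {ffun 'I_n -> 'I_r})%type.
HB.instance Definition _ r n := Finite.on (cperm r n).

Section Statistics.
Variables r n : nat.
Variable le : rel (centry r n).
Variable g : cperm r n.

(* gamma(i) for i in [0, n], with gamma(0) = 0. *)
Definition cperm_at (i : 'I_n.+1) : centry r n :=
  omap (fun k => (g.1 k, g.2 k)) (unlift ord0 i).

Definition cperm_gt (i j : 'I_n.+1) : bool :=
  strictly le (cperm_at j) (cperm_at i).

Definition cDes : {set 'I_n} :=
  [set j : 'I_n | cperm_gt (widen_ord (leqnSn n) j) (lift ord0 j)].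
Definition cdes : nat := #|cDes|.
Definition cmaj : nat := \sum_(j in cDes) j.
Definition cinv : nat :=
  #|[set ij : 'I_n * 'I_n |
      (ij.1 < ij.2) && cperm_gt (lift ord0 ij.1) (lift ord0 ij.2)]|.
Definition clen : nat :=
  cinv + \sum_(i < n | 0 < g.2 i) ((g.1 i).+1 + g.2 i - 1).
Definition ccol : nat := \sum_(i < n) g.2 i.

End Statistics.

(* Main.v *)
Require Import Defs.
From mathcomp Require Import all_boot all_order all_algebra all_fingroup.
From HB Require Import structures.
From mathcomp Require Import boolp ring zify.

(** Fix the coloring d of the values.  The entries 0 and v^(d v) are then n + 1
    elements of a chain, and replacing each of them by its rank turns the words
    0, gamma(1), ..., gamma(n) with this coloring into the permutations w of
    [0, n] such that w(0) is the number l of colored values: a positive-dominant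
    order puts exactly the colored entries below 0.  Descents and inversions
    only depend on w, and the remaining part of len and col only on d
    (sum_value_coloring), so the order enters only through l.

    For fixed l, the generating function wsum n l of these permutations is
    computed by deleting the first letter w(0) = l.  What is left is
    standardized to start with some letter j.  A descent is lost if and only if
    j < l; the descents that stay are shifted by one position, which is the
    substitution t -> q t.  The letter at position 0 is not counted in
    inversions, so the j inversions of the new first letter are lost.
    This gives the recursion wsum_rec.  The series front_series n l satisfies
    the same recursion after multiplication by (1 - t)(1 - t q) ...
    (1 - t q^n) (front_series_rec).  Its coefficient of t^k is
      sum_i p^(i l) [n - l choose i] [n - i]! q^(k i) E_k(n - i),
    where E_k(m) is the coefficient of u^m in e[u] e[q u] ... e[q^(k-1) u]; here
    i is the length of the initial block of uncolored increasing entries, the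
    remaining blocks being accounted for by E_k.  Summing over the first
    letter is the hockey-stick identity for q-binomials, and passing from k to
    k + 1 is E_(k+1) = E_k e[q^k u].

    It remains to sum over d.  The polynomial in X recording the number of
    colored values is a product over v of 1 + x p^(v+1) X, expanded by the
    q-binomial theorem (color_weight_genfun); a second use of that theorem
    shows that the weights of the i-th terms add up to [n]_(r,a)! / [i]_(r,a)!
    (sum_color_front).  So the coefficient of t^k in the quotient
    by (1 - t) ... (1 - t q^n) is [n]_(r,a)! times the coefficient of u^n in
    E_k(u) times the last exponential, which is the theorem. *)

Set Implicit Arguments.
Unset Strict Implicit.
Unset Printing Implicit Defensive.

Import GRing.Theory.
Local Open Scope ring_scope.

(** * Coefficients of formal power series *)

Section SeriesCoefficients.
Variable B : comNzRingType.
Implicit Types (b c : B) (f g : fps B).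

Fact fpsC_is_zmod_morphism : zmod_morphism (@fpsC B).
Proof.
move=> b c; apply: fpsP => n.
by rewrite fpsDE fpsNE /=; case: eqP; rewrite ?subr0.
Qed.
HB.instance Definition _ :=
  GRing.isZmodMorphism.Build B (fps B) (@fpsC B) fpsC_is_zmod_morphism.

Lemma fps_coefCM b f n : (fpsC b * f) n = b * f n.
Proof.
rewrite fpsME big_ord_recl /= subn0 big1 ?addr0 // => i _; exact: mul0r.
Qed.

Fact fpsC_is_monoid_morphism : monoid_morphism (@fpsC B).
Proof.
split=> [//|b c]; apply: fpsP => n; rewrite fps_coefCM /=.
by case: eqP; rewrite ?mulr0.
Qed.
HB.instance Definition _ :=
  GRing.isMonoidMorphism.Build B (fps B) (@fpsC B) fpsC_is_monoid_morphism.

Lemma fps_coefXM f n : (fpsX B * f) n = if n is m.+1 then f m else 0.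
Proof.
rewrite fpsME big_ord_recl mul0r add0r; case: n => [|n].
  by rewrite big_ord0.
rewrite big_ord_recl mul1r subn1 big1 ?addr0 //.
by move=> i _; rewrite mul0r.
Qed.

Lemma fps_coefXn k n : (fpsX B ^+ k) n = (n == k)%:R.
Proof.
by elim: k n => [|k IHk] [|n] //; rewrite exprS fps_coefXM ?IHk.
Qed.

Lemma fps_coef_sum (I : Type) (s : seq I) (P : pred I) (F : I -> fps B) n :
  (\sum_(i <- s | P i) F i) n = \sum_(i <- s | P i) F i n.
Proof. exact: (big_morph (fun f : fps B => f n) (fun f g => fpsDE f g n)). Qed.

Definition fps_coef0 f : B := f 0%N.

Fact fps_coef0_is_zmod_morphism : zmod_morphism fps_coef0.
Proof. by []. Qed.
HB.instance Definition _ := GRing.isZmodMorphism.Build (fps B) B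
  fps_coef0 fps_coef0_is_zmod_morphism.

Fact fps_coef0_is_monoid_morphism : monoid_morphism fps_coef0.
Proof.
by split=> // f g; rewrite /fps_coef0 fpsME big_ord_recl big_ord0 addr0.
Qed.
HB.instance Definition _ := GRing.isMonoidMorphism.Build (fps B) B
  fps_coef0 fps_coef0_is_monoid_morphism.

Section Dilation.
Variable c : B.

Fact fps_dilate_is_zmod_morphism : zmod_morphism (fps_dilate c).
Proof. by move=> f g; apply: fpsP => n; exact: mulrBr. Qed.
HB.instance Definition _ := GRing.isZmodMorphism.Build (fps B) (fps B)
  (fps_dilate c) fps_dilate_is_zmod_morphism.

Lemma fps_dilateC b : fps_dilate c (fpsC b) = fpsC b.
Proof. by apply: fpsP => -[|n] /=; rewrite ?mul1r ?mulr0. Qed.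

Fact fps_dilate_is_monoid_morphism : monoid_morphism (fps_dilate c).
Proof.
split=> [|f g]; first exact: fps_dilateC.
apply: fpsP => n; rewrite fpsME -[LHS]/(c ^+ n * (f * g) n) fpsME mulr_sumr.
apply: eq_bigr => i _ /=.
by rewrite mulrACA -exprD subnKC // -ltnS.
Qed.
HB.instance Definition _ := GRing.isMonoidMorphism.Build (fps B) (fps B)
  (fps_dilate c) fps_dilate_is_monoid_morphism.

Lemma fps_dilateX : fps_dilate c (fpsX B) = fpsC c * fpsX B.
Proof.
apply: fpsP => n; rewrite fps_coefCM /=.
by case: eqP => [->|]; rewrite ?mulr0.
Qed.

End Dilation.
End SeriesCoefficients.

Definition fps_map (A B : Type) (h : A -> B) (f : fps A) : fps B :=
  Fps (fun n => h (f n)).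

Lemma fps_map_monoid_morphism (A B : comNzRingType) (h : {rmorphism A -> B}) :
  monoid_morphism (fps_map h).
Proof.
split=> [|f g]; apply: fpsP => n.
  by rewrite fps1E -[LHS]/(h ((1 : fps A) n)) fps1E rmorph_nat.
rewrite fpsME -[LHS]/(h ((f * g) n)) fpsME rmorph_sum.
by apply: eq_bigr => i _; rewrite rmorphM.
Qed.

(** Each term of the first sum of the theorem lives on a single power of u, each
    term of the second one on a single power of t.  So a given coefficient of
    the limit comes from one term of either sum. *)
Section Summation.
Variable A : comNzRingType.

Lemma fps2_sums_inner (x y : nat -> fps A) :
  fps2_sums (fun n => fpsC (x n) * (fpsC (y n) * fpsX (fps A) ^+ n))
            (Fps (fun n => x n * y n)).
Proof.
move=> m n; exists m.+1 => K lt_mK; rewrite fps_coef_sum.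
rewrite (big_only1 (Ordinal lt_mK)) //.
  by rewrite !fps_coefCM fps_coefXn eqxx mulr1.
move=> k; rewrite -val_eqE eq_sym => /negPf neq_km _.
by rewrite !fps_coefCM fps_coefXn neq_km !mulr0.
Qed.

Lemma fps2_sums_outer (G : nat -> fps (fps A)) (c : nat -> nat -> A) :
    (forall k m, G k m = fpsC (c m k)) ->
  fps2_sums (fun k => fpsC (fpsX A ^+ k) * G k) (Fps (fun m => Fps (c m))).
Proof.
move=> GE m n; exists n.+1 => K lt_nK; rewrite fps_coef_sum.
under eq_bigr do rewrite fps_coefCM GE mulrC.
rewrite fps_coef_sum (big_only1 (Ordinal lt_nK)) //.
  by rewrite fps_coefCM fps_coefXn eqxx mulr1.
move=> k; rewrite -val_eqE eq_sym => /negPf neq_kn _.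
by rewrite fps_coefCM fps_coefXn neq_kn mulr0.
Qed.

End Summation.

(** * Gaussian binomial coefficients *)

Section QBinomials.
Variables (B : comUnitRingType) (p : B).

Lemma qint_recl n : qint p n.+1 = 1 + p * qint p n.
Proof.
rewrite /qint big_ord_recl mulr_sumr; congr (_ + _).
by apply: eq_bigr => i _; rewrite exprS.
Qed.

Lemma qint_split k n : qint p (k + n) = qint p k + p ^+ k * qint p n.
Proof.
rewrite /qint big_split_ord mulr_sumr; congr (_ + _).
by apply: eq_bigr => i _; rewrite exprD.
Qed.

Lemma qfact0 : qfact p 0 = 1.
Proof. by rewrite /qfact big_nil. Qed.

Lemma qfactS n : qfact p n.+1 = qint p n.+1 * qfact p n.
Proof. by rewrite /qfact big_nat_recr //= mulrC. Qed.

(** Gaussian binomial coefficients through a Pascal rule rather than as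
    quotients of q-factorials, so that they vanish for n < k. *)
Fixpoint qbinom n k : B :=
  if n is m.+1 then
    if k is l.+1 then qbinom m l + p ^+ l.+1 * qbinom m l.+1 else 1
  else (k == 0%N)%:R.

Lemma qbinom0 n : qbinom n 0 = 1.
Proof. by case: n. Qed.

Lemma qbinom_small n k : (n < k)%N -> qbinom n k = 0.
Proof.
elim: n k => [|n IHn] [|k] //=; rewrite ltnS => lt_nk.
by rewrite !IHn ?mulr0 ?addr0 // (leq_trans lt_nk).
Qed.

Lemma qbinom_fact n k :
  (k <= n)%N -> qbinom n k * (qfact p k * qfact p (n - k)) = qfact p n.
Proof.
elim: n k => [|n IHn] [|k] //=; first by rewrite qfact0 !mul1r.
  by rewrite qfact0 subn0 !mul1r.
rewrite ltnS subSS leq_eqVlt => /predU1P[->|lt_kn].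
  rewrite (@qbinom_small n n.+1) // mulr0 addr0 subnn qfactS.
  by rewrite -[in RHS](IHn n) // subnn mulrA mulrA (mulrC (qbinom n n)) -!mulrA.
have Dnk : (n - k = (n - k.+1).+1)%N by rewrite subnSK.
rewrite [RHS]qfactS.
have -> : qint p n.+1 = qint p k.+1 + p ^+ k.+1 * qint p (n - k).
  by rewrite -qint_split addSn subnKC // ltnW.
have IH1 := IHn k (ltnW lt_kn); have IH2 := IHn k.+1 lt_kn.
move: IH1 IH2; rewrite qfactS Dnk !qfactS -Dnk => IH1 IH2.
rewrite mulrDl [RHS]mulrDl -{1}IH1 -IH2; ring.
Qed.

(** The hockey-stick identity: peeling off the term j = l is one Pascal step. *)
Lemma qbinom_hockey i l n : (l <= n.+1)%N ->
  \sum_(l <= j < n.+1) p ^+ (i.+1 * j) * qbinom (n - j) i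
    = p ^+ (i.+1 * l) * qbinom (n.+1 - l) i.+1.
Proof.
move=> le_ln; have [d Dd] : exists d, d = (n.+1 - l)%N by exists (n.+1 - l)%N.
elim: d l le_ln Dd => [|d IHd] l le_ln Dd.
  by rewrite qbinom_small -?Dd // mulr0 big_geq // -subn_eq0 -Dd.
have lt_ln : (l < n.+1)%N by rewrite -subn_gt0 -Dd.
rewrite big_ltn // IHd //; last by rewrite subnS -Dd.
rewrite -Dd /= mulrDr subSS.
have -> : (n - l)%N = d by lia.
by rewrite mulnS exprD; ring.
Qed.

(** The q-binomial theorem.  Peeling off the first factor 1 + x X leaves the
    product for x p, and the two resulting terms add up by the Pascal rule. *)
Lemma qbinomial_theorem n (x : B) :
  \prod_(v < n) (1 + (x * p ^+ v)%:P * 'X)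
    = \sum_(l < n.+1) (x ^+ l * p ^+ 'C(l, 2) * qbinom n l)%:P * 'X^l
    :> {poly B}.
Proof.
elim: n x => [|n IHn] x; first by rewrite big_ord0 big_ord1 !mul1r.
rewrite big_ord_recl mulr1.
under eq_bigr do rewrite lift0 exprS mulrA.
rewrite {}IHn mulrDl mul1r [in RHS]big_ord_recl.
under [X in _ = _ + X]eq_bigr => i _ do
  rewrite lift0 -[qbinom n.+1 i.+1]/(qbinom n i + p ^+ i.+1 * qbinom n i.+1)
          mulrDr polyCD mulrDl.
rewrite big_split /= [X in _ = _ + (_ + X)]big_ord_recr /= qbinom_small //.
rewrite !mulr0 mul0r addr0 [RHS]addrCA [LHS]addrC; congr (_ + _).
  rewrite mulr_sumr; apply: eq_bigr => i _.
  rewrite binS bin1 exprD [x ^+ i.+1]exprS exprMn [in RHS]exprS !polyCM.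
  ring.
rewrite big_ord_recl qbinom0; congr (_ + _).
by apply: eq_bigr => i _; rewrite lift0 exprMn; congr (_ %:P * _); ring.
Qed.

(** The summation bound may exceed m, because the terms beyond m vanish. *)
Lemma qbinomial_theorem_eval m n x : (m <= n)%N ->
  \sum_(l < n.+1) x ^+ l * p ^+ 'C(l, 2) * qbinom m l
    = \prod_(v < m) (1 + x * p ^+ v).
Proof.
move=> le_mn; have := congr1 (horner^~ 1) (qbinomial_theorem m x).
rewrite horner_prod horner_sum.
under eq_bigr do rewrite hornerD hornerM !hornerC hornerX mulr1.
under [in RHS]eq_bigr do rewrite hornerM hornerC hornerXn expr1n mulr1.
move=> ->; pose F l := x ^+ l * p ^+ 'C(l, 2) * qbinom m l.
rewrite -!(big_mkord xpredT F).
have le_m_n : (m.+1 <= n.+1)%N by [].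
rewrite (big_cat_nat _ le_m_n) //= -[RHS]addr0; congr (_ + _).
rewrite big_nat_cond big1 // => l.
by rewrite andbT /F => /andP[lt_ml _]; rewrite qbinom_small ?mulr0.
Qed.

End QBinomials.

(** * The block sums and their recursion *)

Section BlockSums.
Variables (B : comUnitRingType) (p q : B).
Hypothesis qfact_unit : forall n, qfact p n \is a GRing.unit.

Definition qexp_prod k : fps B := \prod_(j < k) fps_dilate (q ^+ j) (qexp p).

Lemma qexp_prod0 k : qexp_prod k 0%N = 1.
Proof.
rewrite -/(fps_coef0 _) rmorph_prod big1 //= => j _.
by rewrite /fps_coef0 /= qfact0 invr1 mulr1.
Qed.

(** The weight, in the coefficient of t^k, of the words with l colored values:
    i is the length of the initial block of increasing uncolored entries, which
    are chosen among n - l, and each of them passes the l colored entries. *)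
Definition front_sum n l k : B :=
  \sum_(i < n.+1) p ^+ (i * l) * qbinom p (n - l) i * qfact p (n - i)
                    * (q ^+ (k * i) * qexp_prod k (n - i)%N).

(** The hockey-stick identity raises the index i by one, so the sum misses
    exactly the term i = 0 of front_sum for n + 1. *)
Lemma front_sum_tail n l k : (l <= n.+1)%N ->
  q ^+ k * \sum_(l <= j < n.+1) p ^+ j * front_sum n j k
    = front_sum n.+1 l k - qfact p n.+1 * qexp_prod k n.+1.
Proof.
move=> le_ln; rewrite /front_sum [X in _ = X - _]big_ord_recl.
rewrite qbinom0 mul0n muln0 !mul1r subn0 addrC addKr.
under [in LHS]eq_bigr do rewrite mulr_sumr.
rewrite exchange_big mulr_sumr; apply: eq_bigr => i _.
rewrite lift0 subSS -(qbinom_hockey p i le_ln) !mulr_suml mulr_sumr.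
by apply: eq_bigr => j _; rewrite !mulSn mulnS !exprD; ring.
Qed.

(** For l = 0 the sum over i is the product of E_k by e[q^k u]. *)
Lemma front_sum0 n k : front_sum n 0 k = qfact p n * qexp_prod k.+1 n.
Proof.
have -> : qexp_prod k.+1 = fps_dilate (q ^+ k) (qexp p) * qexp_prod k.
  by rewrite /qexp_prod big_ord_recr mulrC.
rewrite fpsME mulr_sumr.
apply: eq_bigr => i _; rewrite muln0 mul1r subn0 /=.
have le_in : (i <= n)%N by rewrite -ltnS.
rewrite -exprM -{1}(qbinom_fact p le_in).
transitivity (qfact p i * (qfact p i)^-1
  * (qbinom p n i * qfact p (n - i) * (q ^+ (k * i) * qexp_prod k (n - i)%N))).
  by rewrite divrr // mul1r.
ring.
Qed.

Lemma front_sum_head n l k : (l <= n.+1)%N ->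
  q ^+ k * \sum_(0 <= j < l) p ^+ j * front_sum n j k
    = qfact p n.+1 * qexp_prod k.+1 n.+1 - front_sum n.+1 l k.
Proof.
move=> le_ln; rewrite -front_sum0.
have := front_sum_tail k (leq0n n.+1); rewrite (big_cat_nat _ le_ln) //= mulrDr.
rewrite (front_sum_tail k le_ln) => /(canRL (addrK _)) ->; ring.
Qed.

Definition front_series n l : fps B := Fps (front_sum n l).

(** The recursion that deleting the first letter of a permutation gives for the
    sums wsum below, after removal of the factor 1 - t.  In the coefficient
    of t^(k+1), the letters j < l contribute front_sum_head at k and the others
    front_sum_tail at k + 1, and the two q-factorial terms cancel. *)
Lemma front_series_rec n l : (l <= n.+1)%N ->
  (1 - fpsX B) * front_series n.+1 l
    = \sum_(j < n.+1) fpsX B ^+ (j < l)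
                        * (fpsC (p ^+ j) * fps_dilate q (front_series n j)).
Proof.
move=> le_ln; pose F j := fpsC (p ^+ j) * fps_dilate q (front_series n j).
rewrite -(big_mkord xpredT (fun j => fpsX B ^+ (j < l) * F j)).
rewrite (big_cat_nat _ le_ln) //=.
rewrite (eq_big_nat _ _ (F2 := fun j => fpsX B * F j)); last first.
  by move=> j /andP[_ ->].
rewrite [X in _ = _ + X](eq_big_nat _ _ (F2 := F)); last first.
  by move=> j /andP[le_lj _]; rewrite ltnNge le_lj mul1r.
have coef m1 m2 k : (\sum_(m1 <= j < m2) F j) k
    = q ^+ k * \sum_(m1 <= j < m2) p ^+ j * front_sum n j k.
  rewrite fps_coef_sum mulr_sumr; apply: eq_bigr => j _.
  by rewrite fps_coefCM /= mulrCA.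
rewrite -mulr_sumr; apply: fpsP => k.
rewrite mulrBl mul1r !fpsDE fpsNE !fps_coefXM coef front_sum_tail //.
case: k => [|k].
  by rewrite /qexp_prod big_ord0 fps1E mulr0 !subr0 add0r.
rewrite coef front_sum_head //=; ring.
Qed.

Lemma front_series00 : (1 - fpsX B) * front_series 0 0 = 1.
Proof.
have coef k : front_series 0 0 k = 1.
  by rewrite /= front_sum0 qfact0 mul1r qexp_prod0.
apply: fpsP => k; rewrite mulrBl mul1r fpsDE fpsNE fps_coefXM fps1E.
by case: k => [|k]; rewrite !coef ?subr0 ?subrr.
Qed.

End BlockSums.

(** * Permutations by their first letter *)

Lemma sum_lift_perm (V : nmodType) n (i j : 'I_n.+1) (F : 'S_n.+1 -> V) :
  \sum_(s : 'S_n.+1 | s i == j) F s = \sum_(s : 'S_n) F (lift_perm i j s).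
Proof.
pose drop (s : 'S_n.+1) : 'S_n :=
  if [pick s' | s == lift_perm i j s'] is Some s' then s' else 1%g.
have lift_permI : injective (lift_perm i j).
  move=> s1 s2 eq_s; apply/permP => k; apply: (@lift_inj _ j).
  by rewrite -!(lift_perm_lift i) eq_s.
rewrite (reindex_onto (lift_perm i j) drop) => [|s /eqP si].
  apply: eq_bigl => s; rewrite lift_perm_id eqxx /drop.
  by case: pickP => [s' /eqP/lift_permI->|/(_ s)]; rewrite eqxx.
rewrite /drop; case: pickP => [s' /eqP->//|no_lift].
have neq_j k : j != s (lift i k).
  by rewrite -si (inj_eq perm_inj) neq_lift.
pose f k := odflt k (unlift j (s (lift i k))).
have fE k : lift j (f k) = s (lift i k).
  by rewrite /f; case: unliftP (neq_j k) => [? ->|->]; rewrite ?eqxx.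
have f_inj : injective f.
  move=> k1 k2 eq_f; apply: (@lift_inj _ i); apply: (@perm_inj _ s).
  by rewrite -!fE eq_f.
case/eqP: (no_lift (perm f_inj)); apply/permP => k.
case: (unliftP i k) => [k'|] ->; last by rewrite lift_perm_id.
by rewrite lift_perm_lift permE fE.
Qed.

Section FirstLetter.
Variables (B : comUnitRingType) (p q : B).
Local Notation t := (fpsX B).

Definition wdesc n (s : 'S_n.+1) (j : 'I_n) : bool :=
  (s (lift ord0 j) < s (widen_ord (leqnSn n) j))%N.

(** Inversions among the positions from 1 on: position 0 holds the letter that
    stands for the entry 0 of a colored permutation. *)
Definition winv n (s : 'S_n.+1) : nat :=
  \sum_(i < n) \sum_(j < n) ((i < j) && (s (lift ord0 j) < s (lift ord0 i)))%N.

Definition wweight n (s : 'S_n.+1) : fps B :=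
  \prod_(j < n) (t * fpsC q ^+ j) ^+ wdesc s j * fpsC (p ^+ winv s).

Definition wsum n (l : nat) : fps B :=
  \sum_(s : 'S_n.+1 | s ord0 == l :> nat) wweight s.

Lemma ltn_lift n (l : 'I_n.+1) (i j : 'I_n) :
  (lift l i < lift l j)%N = (i < j)%N.
Proof. by rewrite /= /bump; case: leqP; case: leqP => /=; lia. Qed.

Lemma sum_perm_lt n (s : 'S_n.+1) (x : 'I_n.+1) :
  (\sum_(j < n.+1) (s j < s x) = s x)%N.
Proof.
rewrite (reindex_inj (@perm_inj _ s^-1)).
under eq_bigr do rewrite permKV.
suff count_lt m k : (\sum_(i < m) (i < k) = minn m k)%N.
  by rewrite count_lt; apply/minn_idPr/ltnW.
elim: m => [|m IHm]; first by rewrite big_ord0 min0n.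
by rewrite big_ord_recr IHm /=; case: ltnP => ? /=; lia.
Qed.

(** Position 0 of s becomes position 1, so its inversions start to count; they
    are as many as the letters below the first one. *)
Lemma winv_lift n (l : 'I_n.+2) (s : 'S_n.+1) :
  winv (lift_perm ord0 l s) = (s ord0 + winv s)%N.
Proof.
rewrite /winv; under eq_bigr => i _ do under eq_bigr => j _ do
  rewrite !lift_perm_lift ltn_lift.
rewrite big_ord_recl; congr (_ + _)%N.
  rewrite -[RHS](sum_perm_lt s ord0) !big_ord_recl !ltnn.
  by congr (_ + _)%N; apply: eq_bigr.
by apply: eq_bigr => i _; rewrite big_ord_recl.
Qed.

(** Putting a letter l in front moves every descent one position to the right,
    which multiplies t by q, and creates a descent at 0 when l exceeds the
    following letter. *)
Lemma wweight_lift n (l : 'I_n.+2) (s : 'S_n.+1) :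
  wweight (lift_perm ord0 l s)
    = t ^+ (s ord0 < l)%N * (fpsC (p ^+ s ord0) * fps_dilate q (wweight s)).
Proof.
rewrite /wweight winv_lift big_ord_recl.
have -> : wdesc (lift_perm ord0 l s) ord0 = (s ord0 < l)%N.
  rewrite /wdesc lift_perm_lift (_ : widen_ord _ _ = ord0); last exact: val_inj.
  by rewrite lift_perm_id /= /bump; case: leqP => /=; lia.
have wdescE (j : 'I_n) : wdesc (lift_perm ord0 l s) (lift ord0 j) = wdesc s j.
  rewrite /wdesc.
  rewrite (_ : widen_ord _ (lift _ _) = lift ord0 (widen_ord (leqnSn n) j)).
    by rewrite !lift_perm_lift ltn_lift.
  exact: val_inj.
under eq_bigr do rewrite wdescE lift0.
rewrite rmorphM rmorph_prod /= fps_dilateC exprD rmorphM !expr0 mulr1.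
under [in RHS]eq_bigr do
  rewrite rmorphXn rmorphM rmorphXn /= fps_dilateC fps_dilateX (mulrC _ t)
          -mulrA -exprS.
ring.
Qed.

Lemma wsum_rec n l : (l <= n.+1)%N ->
  wsum n.+1 l
    = \sum_(j < n.+1)
        t ^+ (j < l)%N * (fpsC (p ^+ j) * fps_dilate q (wsum n j)).
Proof.
rewrite -ltnS => lt_ln; rewrite /wsum.
rewrite (sum_lift_perm ord0 (Ordinal lt_ln)).
rewrite (partition_big (fun s : 'S_n.+1 => s ord0) xpredT) //=.
apply: eq_bigr => j _; rewrite rmorph_sum !mulr_sumr.
apply: eq_big => [s|s /eqP sj]; first by rewrite -val_eqE.
by rewrite wweight_lift sj.
Qed.

Hypothesis qfact_unit : forall n, qfact p n \is a GRing.unit.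

(** Both sides satisfy the same recursion: the factor 1 - t is the one that
    front_series_rec absorbs, and t -> q t shifts the others. *)
Lemma wsumE n l : (l <= n)%N ->
  wsum n l = \prod_(i < n.+1) (1 - t * fpsC q ^+ i) * front_series p q n l.
Proof.
elim: n l => [|n IHn] l le_ln.
  move: le_ln; rewrite leqn0 => /eqP->.
  rewrite big_ord1 expr0 mulr1 front_series00 // /wsum.
  rewrite (sum_lift_perm ord0 ord0).
  rewrite (big_pred1 1%g) => [|s]; last first.
    by apply/esym/eqP/permP => -[].
  by rewrite /wweight /winv !big_ord0 mul1r.
rewrite wsum_rec // big_ord_recl expr0 mulr1 -mulrA mulrCA front_series_rec //.
rewrite mulr_sumr; apply: eq_bigr => j _.
rewrite IHn; last by rewrite -ltnS.
rewrite rmorphM rmorph_prod /=.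
under [in LHS]eq_bigr do rewrite rmorphB rmorph1 rmorphM rmorphXn /=
  fps_dilateC fps_dilateX (mulrC _ t) -mulrA -exprS.
ring.
Qed.

End FirstLetter.

(** * From colored permutations to permutations *)

Lemma rank_perm n (lt : rel 'I_n.+1) :
    irreflexive lt -> transitive lt ->
    (forall v w, v != w -> lt v w || lt w v) ->
  exists rho : 'S_n.+1, forall v w, (rho v < rho w)%N = lt v w.
Proof.
move=> ltxx lt_trans lt_total; pose below v := [set w | lt w v].
have below_small v : (#|below v| < n.+1)%N.
  rewrite -[X in (_ < X)%N]card_ord -cardsT; apply/proper_card/properP.
  by split; [exact: subsetT | exists v; rewrite !inE ?ltxx].
have lt_below v w : lt v w -> (#|below v| < #|below w|)%N.
  move=> lt_vw; apply/proper_card/properP; split.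
    by apply/subsetP => x; rewrite !inE => /lt_trans; apply.
  by exists v; rewrite inE ?ltxx.
pose rk v := Ordinal (below_small v).
have rkE v w : (rk v < rk w)%N = lt v w.
  apply/idP/idP => [/= lt_vw|/lt_below//].
  have neq_vw : v != w by apply: contraTneq lt_vw => ->; rewrite ltnn.
  case/orP: (lt_total v w neq_vw) => // /lt_below.
  by rewrite ltnNge ltnW.
have rk_inj : injective rk.
  move=> v w eq_rk; apply/eqP; apply: contraT => /lt_total.
  by rewrite -!rkE eq_rk ltnn.
by exists (perm rk_inj) => v w; rewrite !permE rkE.
Qed.

Section ValueColoring.
Variables (r n : nat) (le : rel (centry r n)).
Hypothesis le_pd : positive_dominant le.
Implicit Type d : {ffun 'I_n -> 'I_r}.

(** The coloring d is indexed by values; v = 0 gives the entry 0. *)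
Definition value_entry d (v : 'I_n.+1) : centry r n :=
  omap (fun k => (k, d k)) (unlift ord0 v).

Definition ncolored d : nat := \sum_(k < n) (0 < d k)%N.

Lemma ncolored_le d : (ncolored d <= n)%N.
Proof.
rewrite -[X in (_ <= X)%N](card_ord n) -sum1_card.
by apply: leq_sum => k _; case: (0 < _)%N.
Qed.

Lemma value_entry0 d : value_entry d ord0 = None.
Proof. by rewrite /value_entry unlift_none. Qed.

Lemma value_entry_lift d k : value_entry d (lift ord0 k) = Some (k, d k).
Proof. by rewrite /value_entry liftK. Qed.

Lemma value_entry_inj d : injective (value_entry d).
Proof.
move=> v w; rewrite /value_entry.
by case: unliftP => [k|] ->; case: unliftP => [l|] -> //= [->].
Qed.

(** By positive dominance the entries below 0 are exactly the colored ones, so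
    their number is the rank of 0. *)
Lemma value_rank d : exists rho : 'S_n.+1,
    (forall v w,
      (rho v < rho w)%N = strictly le (value_entry d v) (value_entry d w))
  /\ rho ord0 = ncolored d :> nat.
Proof.
have [[le_refl le_anti le_trans le_total] le_pos le_col] := le_pd.
have [||v w neq_vw|rho rhoE] :=
    @rank_perm n (fun v w => strictly le (value_entry d v) (value_entry d w)).
- by move=> v; rewrite /strictly eqxx.
- move=> w v x /andP[neq_vw le_vw] /andP[neq_wx le_wx].
  rewrite /strictly (le_trans _ _ _ le_vw le_wx) andbT.
  apply: contraNneq neq_vw => eq_vx; move: le_vw; rewrite eq_vx => le_xw.
  by apply/eqP/le_anti; rewrite le_xw.
- rewrite /strictly !(inj_eq (@value_entry_inj d)) neq_vw eq_sym neq_vw.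
  exact: le_total.
exists rho; split=> //.
rewrite -(sum_perm_lt rho ord0) big_ord_recl ltnn add0n.
apply: eq_bigr => k _; rewrite rhoE value_entry0 value_entry_lift.
congr (nat_of_bool _); case: (posnP (d k)) => [dk0|dk_gt0]; last exact: le_col.
apply/negP => /andP[_ le_k0].
have /andP[_ le_0k] := le_pos None (Some (k, d k)) (erefl _) dk0 isT.
by have /le_anti : le None (Some (k, d k)) && le (Some (k, d k)) None
  by rewrite le_0k.
Qed.

Variables (B : comUnitRingType) (p q a : B).
Local Notation t := (fpsX B).

(** The part of p^len a^col that depends on the coloring alone.  A value v is
    stored as v - 1, so that v + c - 1 becomes v + d v. *)
Definition color_weight d : B :=
  \prod_(v < n) (p ^+ ((0 < d v) * (v + d v)) * a ^+ d v).

Definition cperm_weight (g : cperm r n) : fps B :=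
  t ^+ cdes le g * fpsC q ^+ cmaj le g * fpsC p ^+ clen le g * fpsC a ^+ ccol g.

(** The colored permutations whose values are colored by d, as pairs of an
    underlying permutation s and of the coloring d o s of the positions. *)
Lemma sum_value_coloring d :
  \sum_(s : 'S_n) cperm_weight (s, [ffun i => d (s i)])
    = fpsC (color_weight d) * wsum p q n (ncolored d).
Proof.
have [rho [rhoE rho0]] := value_rank d.
have reindex_rho :
  \sum_(s : 'S_n.+1 | s ord0 == ncolored d :> nat) wweight p q s
    = \sum_(s : 'S_n) wweight p q (lift_perm ord0 ord0 s * rho)%g.
  rewrite -(sum_lift_perm _ _ (fun s => wweight p q (s * rho)%g)).
  rewrite (reindex_inj (mulIg rho)); apply: eq_bigl => s.
  by rewrite permM -rho0 val_eqE (inj_eq perm_inj).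
rewrite /wsum reindex_rho mulr_sumr; apply: eq_bigr => s _.
set g : cperm r n := (s, _); set w := (_ * rho)%g.
have atE i : cperm_at g i = value_entry d (lift_perm ord0 ord0 s i).
  rewrite /cperm_at; case: (unliftP ord0 i) => [k|] ->.
    by rewrite lift_perm_lift value_entry_lift /= ffunE.
  by rewrite lift_perm_id value_entry0.
have gtE i j : cperm_gt le g i j = (w j < w i)%N.
  by rewrite /cperm_gt !atE /w !permM rhoE.
have desE j : (j \in cDes le g) = wdesc w j by rewrite inE gtE.
have invE : cinv le g = winv w.
  rewrite /cinv -sum1_card big_mkcond /winv pair_bigA /=.
  apply: eq_bigr => ij _.
  by rewrite inE gtE; case: ifP.
have Des_t : t ^+ cdes le g = \prod_(j < n | wdesc w j) t.
  by rewrite -(eq_bigl _ _ desE) prodr_const.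
have Des_q : fpsC q ^+ cmaj le g = \prod_(j < n | wdesc w j) fpsC q ^+ j.
  by rewrite -(eq_bigl _ _ desE) prodrXr.
have lenE : clen le g = (winv w + \sum_(v < n) (0 < d v) * (v + d v))%N.
  rewrite /clen invE big_mkcond [in RHS](reindex_inj (@perm_inj _ s)) /=.
  congr (_ + _)%N; apply: eq_bigr => i _; rewrite ffunE addSn subn1.
  by case: ifP; rewrite ?mul1n ?mul0n.
have colE : ccol g = (\sum_(v < n) d v)%N.
  rewrite /ccol [in RHS](reindex_inj (@perm_inj _ s)).
  by apply: eq_bigr => i _; rewrite ffunE.
rewrite /cperm_weight Des_t Des_q lenE colE /wweight /color_weight.
rewrite -big_split [in RHS]big_split /= !prodrXr rmorphM !rmorphXn exprD /=.
rewrite big_mkcond.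
rewrite (eq_bigr (fun j : 'I_n => (t * fpsC q ^+ j) ^+ wdesc w j)); last first.
  by move=> j _; case: wdesc.
ring.
Qed.

Lemma sum_cperm_weight :
  \sum_(g : cperm r n) cperm_weight g
    = \sum_(d : {ffun 'I_n -> 'I_r})
        fpsC (color_weight d) * wsum p q n (ncolored d).
Proof.
under [RHS]eq_bigr do rewrite -sum_value_coloring.
rewrite exchange_big -(pair_bigA _ (fun s d => cperm_weight (s, d))) /=.
apply: eq_bigr => s _.
rewrite (reindex (fun d : {ffun 'I_n -> 'I_r} => [ffun i => d (s i)])) //.
exists (fun c : {ffun 'I_n -> 'I_r} => [ffun i => c ((s^-1)%g i)]) => c _.
  by apply/ffunP => i; rewrite !ffunE permKV.
by apply/ffunP => i; rewrite !ffunE permK.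
Qed.

End ValueColoring.

(** * Summation over the colorings *)

Section ColorSums.
Variables (B : comUnitRingType) (p a : B) (r : nat).
Hypothesis r_gt0 : (0 < r)%N.
Hypothesis qfact_unit : forall n, qfact p n \is a GRing.unit.
Hypothesis rqfact_unit : forall n, rqfact r a p n \is a GRing.unit.

Lemma qbinom_trinomial n l i : (i <= n)%N ->
  qbinom p n l * qbinom p (n - l) i = qbinom p n i * qbinom p (n - i) l.
Proof.
move=> le_in; have [le_lni|lt_nil] := leqP l (n - i); last first.
  rewrite (@qbinom_small _ p (n - i)) // mulr0.
  have [le_ln|lt_nl] := leqP l n; last by rewrite (@qbinom_small _ p n) ?mul0r.
  by rewrite (@qbinom_small _ p (n - l)) ?mulr0 //; lia.
have le_inl : (i <= n - l)%N by lia.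
have le_ln : (l <= n)%N by lia.
apply: (mulIr (qfact_unit l)); apply: (mulIr (qfact_unit i)).
apply: (mulIr (qfact_unit (n - l - i))).
have <-: (n - i - l = n - l - i)%N by lia.
transitivity (qfact p n).
  rewrite -(qbinom_fact p le_ln) -[in RHS](qbinom_fact p le_inl).
  have -> : (n - i - l = n - l - i)%N by lia.
  ring.
rewrite -(qbinom_fact p le_in) -[in LHS](qbinom_fact p le_lni); ring.
Qed.

(** The factor 1 + color_sum p^n of rqint: a colored value v, with all its
    colors, contributes color_sum p^v to the generating function. *)
Definition color_sum : B := \sum_(j < r | (0 < j)%N) p ^+ j.-1 * a ^+ j.

Lemma rqint_color_sum n : (0 < n)%N ->
  rqint r a p n = (1 + color_sum * p ^+ n) * qint p n.
Proof.
move=> n_gt0; rewrite /rqint (bigD1 (Ordinal r_gt0)) //=; congr ((_ + _) * _).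
rewrite /color_sum mulr_suml; apply: eq_big => [j|j j_neq0].
  by rewrite -val_eqE /= lt0n.
have j_gt0 : (0 < j)%N by rewrite lt0n.
rewrite j_gt0 expr1 mulrC mulrAC -exprD; congr (_ ^+ _ * _); lia.
Qed.

Lemma rqfactE n :
  rqfact r a p n = \prod_(1 <= k < n.+1) (1 + color_sum * p ^+ k) * qfact p n.
Proof.
rewrite /rqfact /qfact -big_split /=; apply: eq_big_nat => k /andP[k_gt0 _].
exact: rqint_color_sum.
Qed.

(** The colors of the values are chosen independently, so this polynomial is a
    product over the values. *)
Lemma color_weight_genfun n :
  \sum_(d : {ffun 'I_n -> 'I_r}) (color_weight p a d)%:P * 'X^(ncolored d)
    = \sum_(l < n.+1)
        ((color_sum * p) ^+ l * p ^+ 'C(l, 2) * qbinom p n l)%:P * 'X^l.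
Proof.
rewrite -qbinomial_theorem.
transitivity (\prod_(v < n) \sum_(j < r)
    (p ^+ ((0 < j)%N * (v + j)) * a ^+ j)%:P * 'X^(0 < j)%N).
  rewrite bigA_distr_bigA; apply: eq_bigr => d _ /=.
  by rewrite big_split /= prodrXr -rmorph_prod.
apply: eq_bigr => v _; rewrite (bigD1 (Ordinal r_gt0)) //= !mul1r.
congr (_ + _); rewrite /color_sum !mulr_suml rmorph_sum mulr_suml.
apply: eq_big => [j|j j_neq0]; first by rewrite -val_eqE /= lt0n.
have j_gt0 : (0 < j)%N by rewrite lt0n.
rewrite j_gt0 mul1n expr1; congr (_ %:P * _).
have -> : (v + j = j.-1 + 1 + v)%N by lia.
rewrite !exprD; ring.
Qed.

(** Coefficient extraction from the previous identity: X^l is replaced by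
    phi l. *)
Lemma sum_color_weight n (phi : nat -> B) :
  \sum_(d : {ffun 'I_n -> 'I_r}) color_weight p a d * phi (ncolored d)
    = \sum_(l < n.+1)
        (color_sum * p) ^+ l * p ^+ 'C(l, 2) * qbinom p n l * phi l.
Proof.
pose ev (P : {poly B}) := \sum_(l < n.+1) P`_l * phi l.
have ev_sum (I : finType) (F : I -> {poly B}) :
  ev (\sum_i F i) = \sum_i ev (F i).
  rewrite /ev exchange_big; apply: eq_bigr => l _.
  by rewrite coef_sum mulr_suml.
have ev_mono c k : (k <= n)%N -> ev (c%:P * 'X^k) = c * phi k.
  rewrite -ltnS => lt_kn; rewrite /ev (bigD1 (Ordinal lt_kn)) //= big1.
    by rewrite coefCM coefXn eqxx mulr1 addr0.
  move=> l /negPf; rewrite coefCM coefXn -val_eqE /= => ->.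
  by rewrite mulr0 mul0r.
transitivity (ev (\sum_(d : {ffun 'I_n -> 'I_r})
    (color_weight p a d)%:P * 'X^(ncolored d))).
  by rewrite ev_sum; apply: eq_bigr => d _; rewrite ev_mono ?ncolored_le.
rewrite color_weight_genfun ev_sum; apply: eq_bigr => l _.
by rewrite ev_mono // -ltnS.
Qed.

(** Trinomial revision turns the product of the two q-binomials into one that
    depends on l only through [n - i choose l], and the q-binomial theorem
    then yields the factors of rqfact from i + 1 to n. *)
Lemma sum_color_front n i : (i <= n)%N ->
  \sum_(d : {ffun 'I_n -> 'I_r}) color_weight p a d
      * (p ^+ (i * ncolored d) * qbinom p (n - ncolored d) i * qfact p (n - i))
    = rqfact r a p n / rqfact r a p i.
Proof.
move=> le_in.
rewrite (sum_color_weight n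
  (fun l => p ^+ (i * l) * qbinom p (n - l) i * qfact p (n - i))).
apply: (mulIr (rqfact_unit i)); rewrite divrK // !rqfactE.
have le_i_n : (i.+1 <= n.+1)%N by [].
rewrite (big_cat_nat _ le_i_n) //= -(qbinom_fact p le_in).
have -> : \prod_(i.+1 <= k < n.+1) (1 + color_sum * p ^+ k)
    = \sum_(l < n.+1) (color_sum * p ^+ i.+1) ^+ l * p ^+ 'C(l, 2)
                       * qbinom p (n - i) l.
  rewrite qbinomial_theorem_eval ?leq_subr //.
  rewrite -{1}(add0n i.+1) big_addn big_mkord subSS; apply: eq_bigr => v _.
  by rewrite addnC exprD mulrA.
transitivity ((\sum_(l < n.+1) (color_sum * p ^+ i.+1) ^+ l * p ^+ 'C(l, 2)
    * qbinom p (n - i) l) * (qbinom p n i * qfact p (n - i))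
    * (\prod_(1 <= k < i.+1) (1 + color_sum * p ^+ k) * qfact p i)).
  2: by ring.
congr (_ * _).
rewrite [RHS]mulr_suml; apply: eq_bigr => l _.
transitivity ((color_sum * p) ^+ l * p ^+ (i * l) * p ^+ 'C(l, 2)
  * (qbinom p n l * qbinom p (n - l) i) * qfact p (n - i)); first by ring.
rewrite qbinom_trinomial // !exprMn -!exprM mulSn exprD; ring.
Qed.

End ColorSums.

(** * The identity for each length *)

Section ColoredEulerMahonian.
Variables (B : comUnitRingType) (p q a : B) (r : nat).
Hypothesis r_gt0 : (0 < r)%N.
Hypothesis qfact_unit : forall n, qfact p n \is a GRing.unit.
Hypothesis rqfact_unit : forall n, rqfact r a p n \is a GRing.unit.
Local Notation t := (fpsX B).

(** The coefficient of u^n in the k-th term of the right-hand side, apart from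
    t^k. *)
Definition carlitz_coef n k : B :=
  (qexp_prod p q k * fps_dilate (q ^+ k) (rqexp r a p)) n.

(** The identity for fixed n: the quotient by (1 - t) ... (1 - t q^n) has the
    coefficients of the right-hand side of the theorem. *)
Lemma sum_cperm_weightE n (le : rel (centry r n)) : positive_dominant le ->
  \sum_(g : cperm r n) cperm_weight le p q a g
    = \prod_(i < n.+1) (1 - t * fpsC q ^+ i)
      * (fpsC (rqfact r a p n) * Fps (carlitz_coef n)).
Proof.
move=> le_pd; rewrite sum_cperm_weight //.
under eq_bigr do rewrite wsumE ?ncolored_le // mulrCA.
rewrite -mulr_sumr; congr (_ * _); apply: fpsP => k.
rewrite fps_coef_sum fps_coefCM.
under eq_bigr do rewrite fps_coefCM /= /front_sum mulr_sumr.
rewrite exchange_big.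
rewrite -[Fps _ k]/((qexp_prod p q k * fps_dilate (q ^+ k) (rqexp r a p)) n).
rewrite [X in _ = _ * fps_coef X n]mulrC fpsME mulr_sumr.
apply: eq_bigr => i _; have le_in : (i <= n)%N by rewrite -ltnS.
transitivity (q ^+ (k * i) * qexp_prod p q k (n - i)%N
    * (rqfact r a p n / rqfact r a p i)); last first.
  by rewrite /= -exprM; ring.
rewrite -(sum_color_front r_gt0) // mulr_sumr; apply: eq_bigr => d _; ring.
Qed.

Lemma qintC m : qint (fpsC p) m = fpsC (qint p m).
Proof.
by rewrite /qint rmorph_sum; apply: eq_bigr => i _; rewrite rmorphXn.
Qed.

Lemma qfactC m : qfact (fpsC p) m = fpsC (qfact p m).
Proof. by rewrite /qfact rmorph_prod; apply: eq_bigr => i _; exact: qintC. Qed.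

Lemma rqfactC m : rqfact r (fpsC a) (fpsC p) m = fpsC (rqfact r a p m).
Proof.
rewrite /rqfact rmorph_prod; apply: eq_bigr => i _ /=.
rewrite /rqint qintC rmorphM; congr (_ * _); rewrite rmorph_sum.
by apply: eq_bigr => j _; rewrite !(rmorphXn, rmorphM).
Qed.

Lemma normalized_sum_cperm_weight n (le : rel (centry r n)) :
  positive_dominant le ->
  (\sum_(g : cperm r n) cperm_weight le p q a g)
      / \prod_(i < n.+1) (1 - t * fpsC q ^+ i)
      * (rqfact r (fpsC a) (fpsC p) n)^-1
    = Fps (carlitz_coef n).
Proof.
move=> le_pd; rewrite (sum_cperm_weightE le_pd) rqfactC.
have prod_unit : \prod_(i < n.+1) (1 - t * fpsC q ^+ i) \is a GRing.unit.
  rewrite fps_unitE -/(fps_coef0 _) rmorph_prod big1 ?unitr1 // => i _.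
  by rewrite rmorphB rmorph1 rmorphM mul0r subr0.
have rq_unit : fpsC (rqfact r a p n) \is a GRing.unit by exact: rmorph_unit.
by rewrite [_ * _ / \prod_(_ < _) _]mulrC mulKr // mulrC mulKr.
Qed.

Lemma coef_carlitz_series k n :
  (\prod_(j < k) fps_dilate (fpsC q ^+ j) (qexp (fpsC p))
     * fps_dilate (fpsC q ^+ k) (rqexp r (fpsC a) (fpsC p))) n
    = fpsC (carlitz_coef n k) :> fps B.
Proof.
have qexpC j : fps_dilate (fpsC q ^+ j) (qexp (fpsC p))
    = fps_map (@fpsC B) (fps_dilate (q ^+ j) (qexp p)).
  by apply: fpsP => m /=; rewrite qfactC -rmorphV // -!rmorphXn -rmorphM.
have rqexpC : fps_dilate (fpsC q ^+ k) (rqexp r (fpsC a) (fpsC p))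
    = fps_map (@fpsC B) (fps_dilate (q ^+ k) (rqexp r a p)).
  by apply: fpsP => m /=; rewrite rqfactC -rmorphV // -!rmorphXn -rmorphM.
have [map1 mapM] := fps_map_monoid_morphism (@fpsC B).
under eq_bigr do rewrite qexpC.
by rewrite rqexpC -(big_morph _ mapM map1) -mapM.
Qed.

End ColoredEulerMahonian.

(** The q-factorials are units because their constant terms in p are 1; taking
    the constant term is abstracted as a morphism h that kills p and reflects
    units. *)
Section ConstantTermUnits.
Variables (B R : comUnitRingType) (h : {rmorphism B -> R}).
Hypothesis unit_h : forall x, (x \is a GRing.unit) = (h x \is a GRing.unit).
Variable p : B.
Hypothesis hp0 : h p = 0.

Lemma qint_map1 n : h (qint p n.+1) = 1.
Proof. by rewrite qint_recl rmorphD rmorphM rmorph1 hp0 mul0r addr0. Qed.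

Lemma qfact_unit_of n : qfact p n \is a GRing.unit.
Proof.
rewrite unit_h rmorph_prod big_nat_cond big1 ?unitr1 // => -[|k] //= _.
exact: qint_map1.
Qed.

Lemma rqfact_unit_of r a n : (0 < r)%N -> rqfact r a p n \is a GRing.unit.
Proof.
move=> r_gt0; rewrite unit_h rmorph_prod big_nat_cond big1 ?unitr1 //.
move=> [|k] //= _.
rewrite rqint_color_sum // rmorphM qint_map1 rmorphD rmorphM rmorphXn hp0.
by rewrite expr0n mulr0 addr0 rmorph1 mulr1.
Qed.

End ConstantTermUnits.

Theorem theorem3p19 (R : comUnitRingType) (r : nat) (r_gt0 : (0 < r)%N)
    (O : forall n : nat, rel (centry r n))
    (O_pd : forall n : nat, positive_dominant (O n)) :
  let T := fps (fps (fps (fps R))) in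
  let p : T := fpsC (fpsC (fpsC (fpsX R))) in
  let a : T := fpsC (fpsC (fpsX (fps R))) in
  let q : T := fpsC (fpsX (fps (fps R))) in
  let t : T := fpsX (fps (fps (fps R))) in
  let u : fps T := fpsX T in
  exists S : fps T,
    fps2_sums
      (fun n => fpsC ((\sum_(g : cperm r n)
                          t ^+ cdes (O n) g * q ^+ cmaj (O n) g
                            * p ^+ clen (O n) g * a ^+ ccol g)
                       / \prod_(i < n.+1) (1 - t * q ^+ i))
                * (fpsC (rqfact r a p n)^-1 * u ^+ n)) S
    /\
    fps2_sums
      (fun k => fpsC (t ^+ k)
                * (\prod_(j < k) fps_dilate (q ^+ j) (qexp p))
                * fps_dilate (q ^+ k) (rqexp r a p)) S.
Proof.
move=> T p a q t u.
pose B : comUnitRingType := fps (fps (fps R)).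
pose pB : B := fpsC (fpsC (fpsX R)); pose aB : B := fpsC (fpsX (fps R)).
pose qB : B := fpsX (fps (fps R)).
pose h : {rmorphism B -> R} :=
  (@fps_coef0 R \o @fps_coef0 (fps R) \o @fps_coef0 (fps (fps R)))%FUN.
have unit_h (x : B) : (x \is a GRing.unit) = (h x \is a GRing.unit) by [].
have hp0 : h pB = 0 by [].
have qfact_unit := qfact_unit_of unit_h hp0.
have rqfact_unit n := rqfact_unit_of unit_h hp0 aB n r_gt0.
pose c := carlitz_coef pB qB aB r.
exists (Fps (fun n => Fps (c n))); split; last first.
  under eq_fun do rewrite -mulrA.
  exact: fps2_sums_outer (coef_carlitz_series qB qfact_unit rqfact_unit).
have -> : Fps (fun n => Fps (c n)) = Fps (fun n =>
    (\sum_(g : cperm r n) cperm_weight (O n) pB qB aB g)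
      / \prod_(i < n.+1) (1 - t * q ^+ i) * (rqfact r a p n)^-1) :> fps T.
  apply: fpsP => n; symmetry.
  exact: normalized_sum_cperm_weight r_gt0 qfact_unit rqfact_unit _ _ (O_pd n).
exact: fps2_sums_inner.
Qed.
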